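(* For each $n$ let $G=G(n)$ be a graph on $n$ vertices with maximum degree at most $\Delta=\Delta(n)$, and let $L$ be a random $(2,\mathcal{C})$-list assignment for $G$, where $|\mathcal{C}|=\sigma=\sigma(n)$. If either (i) $\Delta=o\left(n^{1/2}\right)$ and $\sigma=\omega\left(n^{1/4}\Delta^{1/2}\right)$, or (ii) $\Delta=\Omega\left(n^{1/2}\right)$ and $\sigma=\omega(\Delta)$, then with high probability $G$ is $L$-colorable.
   Context: Graphs are finite and simple. A list assignment $L$ for a graph $G$ assigns to each vertex $v$ a set $L(v)$ of colors. $G$ is $L$-colorable if there is a proper vertex coloring $\varphi$ of $G$ with $\varphi(v)\in L(v)$ for every $v\in V(G)$. A random $(k,\mathcal{C})$-list assignment for $G$, where $\mathcal{C}=\{1,2,\dots,\sigma\}$ (with $\sigma=\sigma(n)\ge k$), is obtained by choosing, for each vertex $v$, the list $L(v)$ independently and uniformly at random from all $k$-element subsets of $\mathcal{C}$; here $k=2$. An event $A_n$ occurs with high probability if $\lim_{n\to\infty}\mathbb{P}[A_n]=1$. Asymptotic notation is with respect to $n\to\infty$. *)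

(* Defs.v *)
From HB Require Import structures.
From mathcomp Require Import all_boot all_order all_algebra.
From mathcomp Require Import all_classical all_reals all_analysis.

Set Implicit Arguments.
Unset Strict Implicit.
Unset Printing Implicit Defensive.

Import Order.TTheory GRing.Theory Num.Theory.
Import numFieldNormedType.Exports.

Local Open Scope ring_scope.

Record sgraph (V : finType) := SGraph {
  adj :> rel V;
  adj_sym : symmetric adj;
  adj_irrefl : irreflexive adj
}.

Definition degree (V : finType) (G : sgraph V) (v : V) : nat :=
  #|[set w | G v w]|.

Definition max_degree (V : finType) (G : sgraph V) : nat :=
  (\max_(v : V) degree G v)%N.

Definition list_assignment (V C : finType) := {ffun V -> {set C}}.

Definition list_colorable (V C : finType) (G : sgraph V)
    (L : list_assignment V C) : bool :=
  [exists phi : {ffun V -> C},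
     [forall v, phi v \in L v]
     && [forall v, forall w, G v w ==> (phi v != phi w)]].

Definition klist_pmf (R : realType) (C : finType) (k : nat) (S : {set C}) : R :=
  if #|S| == k then ('C(#|C|, k)%:R)^-1 else 0.

(* The lists are independent, so the law of L is the product over the vertices
   of the uniform law on the k-subsets of the set of colors. *)
Definition list_prob (R : realType) (V C : finType) (k : nat)
    (A : pred (list_assignment V C)) : R :=
  \sum_(L : list_assignment V C | A L) \prod_(v : V) klist_pmf R k (L v).

Lemma klist_pmf_sum1 (R : realType) (C : finType) (k : nat) :
  (k <= #|C|)%N -> \sum_(S : {set C}) klist_pmf R k S = 1.
Proof.
move=> kC; rewrite -big_mkcond /= sumr_const.
have -> : #|[pred S : {set C} | #|S| == k]| = 'C(#|C|, k).
  by rewrite -card_draws; apply: eq_card => S; rewrite !inE.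
by rewrite -(mulr_natr _^-1) mulVf // pnatr_eq0 -lt0n bin_gt0.
Qed.

Lemma list_prob_true (R : realType) (V C : finType) (k : nat) :
  (k <= #|C|)%N -> @list_prob R V C k predT = 1.
Proof.
move=> kC; rewrite /list_prob -(bigA_distr_bigA (fun _ => @klist_pmf R C k)).
by apply: big1 => v _; apply: klist_pmf_sum1.
Qed.

(* Main.v *)
Require Import Defs.
From mathcomp Require Import all_boot all_order all_algebra.
From mathcomp Require Import all_classical all_reals all_analysis.
From mathcomp Require Import zify ring lra.

(** Choosing a proper colouring from lists of size two is a 2-SAT problem:
    giving colour c to v forces every neighbour y of v whose list contains c to
    take the other colour of its list.  As for 2-SAT, if no colouring exists,
    then some vertex x has both of its choices on a common directed cycle of
    forcings ([colorable_of_acyclic]).  Following that cycle from x until a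
    vertex repeats gives a bicycle ([bicycle_of_cycle]): a path z_0, ..., z_k of
    distinct vertices of G with k >= 2 and colours c_0, ..., c_(k+1) such that
    z_t has the list {c_t, c_(t+1)}, and both end colours c_0 and c_(k+1) already
    occur among the k inner colours c_1, ..., c_k.

    The theorem is the first moment bound for bicycles.  With n vertices, maximum
    degree D and s colours there are at most n D^k paths, s^k choices of inner
    colours and k^2 choices of the positions where the end colours occur, and
    each resulting family of k + 1 prescribed lists has probability
    binom(s, 2)^-(k+1) <= (4 / s^2)^(k+1).  So the expected number of bicycles is
    at most the sum over k >= 2 of

      n D^k s^k k^2 (4 / s^2)^(k+1)
        = 64 (n D^2 / s^4) k^2 (4 D / s)^(k-2),

    which is O(n D^2 / s^4) once D / s is small ([prob_uncolorable_le]).  The two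
    repeated end colours are what brings the count down to this order, and k >= 2
    is essential: a term for k = 1 would be larger by a factor of order s / D.

    It remains that D = o(s) and n D^2 = o(s^4) under either hypothesis.  In case
    (i), eventually D <= n^(1/2), so D <= n^(1/4) D^(1/2) = o(s), and the fourth
    power of the right-hand estimate is the second claim.  In case (ii),
    n = O(D^2), so n D^2 = O(D^4) = o(s^4). *)

Set Implicit Arguments.
Unset Strict Implicit.
Unset Printing Implicit Defensive.

Import Order.TTheory GRing.Theory Num.Theory.
Import numFieldNormedType.Exports.

(** * Repetitions in sequences *)

Lemma uniq_prefix (T : eqType) (s t : seq T) :
  uniq s -> ~~ uniq (s ++ t) ->
  exists t1 u t2, [/\ t = t1 ++ u :: t2, uniq (s ++ t1) & u \in s ++ t1].
Proof.
elim: t s => [|u t IH] s us; first by rewrite cats0 us.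
move=> nu; have [uins|unins] := boolP (u \in s).
  by exists [::], u, t; rewrite cats0.
have us' : uniq (rcons s u) by rewrite rcons_uniq unins.
have [|t1 [w [t2 [-> u1 ws]]]] := IH _ us'; first by rewrite cat_rcons.
by exists (u :: t1), w, t2; rewrite -(cat_rcons u s).
Qed.

Lemma split_repeat (T U : eqType) (f : T -> U) (s : seq T) :
  ~~ uniq [seq f x | x <- s] ->
  exists s1 x s2 y s3, s = s1 ++ x :: s2 ++ y :: s3 /\ f x = f y.
Proof.
elim: s => //= x s IH; rewrite negb_and negbK => /orP[/mapP[y ys fxy]|/IH].
  by case/splitPr: ys => s2 s3; exists [::], x, s2, y, s3.
by case=> s1 [u [s2 [y [s3 [-> fuy]]]]]; exists (x :: s1), u, s2, y, s3.
Qed.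

(** * Forcing between choices of colours *)

Section Forcing.
Variables (V C : finType) (G : sgraph V) (L : list_assignment V C).
Hypothesis card_L : forall v, #|L v| = 2.
Implicit Types (x y : V * C) (S : {set V * C}).

(** A pair (v, c) stands for the choice of colour c at v; these pairs are the
    literals of the 2-SAT instance, and [forces] is its implication graph. *)
Definition forces : rel (V * C) := fun x y =>
  [&& G x.1 y.1, x.2 \in L y.1, y.2 \in L y.1 & y.2 != x.2].

Definition opposite : rel (V * C) := fun x y =>
  [&& x.1 == y.1, x.2 \in L x.1, y.2 \in L x.1 & x.2 != y.2].

Lemma list_eq_set2 v c d : c \in L v -> d \in L v -> c != d -> L v = [set c; d].
Proof.
move=> cL dL cd; apply/esym/eqP; rewrite eqEcard card_L cards2 cd andbT.
by apply/fintype.subsetP => e /set2P[] ->.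
Qed.

Lemma opposite_sym x y : opposite x y = opposite y x.
Proof.
rewrite /opposite [y.1 == _]eq_sym [y.2 == _]eq_sym.
by case: eqP => //= ->; rewrite andbCA.
Qed.

Lemma opposite_exists x : x.2 \in L x.1 -> exists y, opposite x y.
Proof.
move=> xL; have /card_gt0P[d] : 0 < #|L x.1 :\ x.2|.
  by move: (cardsD1 x.2 (L x.1)); rewrite xL card_L add1n => -[<-].
rewrite !inE => /andP[dx dL]; exists (x.1, d).
by rewrite /opposite /= eqxx xL dL eq_sym.
Qed.

(** The implication graph of a 2-SAT instance is invariant under contraposition:
    the same colour at both ends of an edge of G is excluded symmetrically. *)
Lemma forces_contra x y x' y' :
  forces x y -> opposite x x' -> opposite y y' -> forces y' x'.
Proof.
case: x y x' y' => [v c] [w d] [v' c'] [w' d'].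
rewrite /forces /opposite /=.
case/and4P=> vw cw dw dc /and4P[/eqP<- cv c'v cc'] /and4P[/eqP<- _ d'w dd'].
have: d' \in [set c; d] by rewrite -(@list_eq_set2 w) // eq_sym.
case/set2P=> [->|d'd]; last by rewrite d'd eqxx in dd'.
by rewrite adj_sym vw cv c'v eq_sym.
Qed.

Lemma connect_contra x y x' y' :
  connect forces x y -> opposite x x' -> opposite y y' -> connect forces y' x'.
Proof.
have oppU z u w : opposite z u -> opposite z w -> u = w.
  case: z u w => [v c] [v1 d] [v2 e]; rewrite /opposite /=.
  case/and4P=> /eqP<- cL dL cd /and4P[/eqP<- _ eL ce]; congr pair.
  have: e \in [set c; d] by rewrite -(@list_eq_set2 v).
  by case/set2P=> // ec; rewrite ec eqxx in ce.
case/connectP=> p; elim: p x x' => [|z p IH] x x' /=.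
  by move=> _ -> xx' xy'; rewrite (oppU _ _ _ xx' xy').
case/andP=> xz zp yE xx' yy'.
have [z' zz'] : exists z', opposite z z'.
  by apply: opposite_exists; case/and4P: xz.
apply: connect_trans (IH _ _ zp yE zz' yy') _.
by apply: connect1; apply: forces_contra xz xx' zz'.
Qed.

(** Take a maximal consistent set S of choices that is closed under forcing.  If a
    vertex had no choice in S, then one of its two choices x does not force the
    other one, so the closure T of x is consistent by contraposition.  A choice
    in S opposite to one in T would, again by contraposition, force the opposite
    of x, which would then be in S.  So S and T together contradict maximality. *)
Lemma colorable_of_acyclic :
  (forall x y, opposite x y -> connect forces x y -> ~~ connect forces y x) ->
  list_colorable G L.
Proof.
move=> acyc.
pose good S := [&& [forall x in S, x.2 \in L x.1],
  [forall x in S, forall y, forces x y ==> (y \in S)] &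
  [forall x in S, forall y in S, ~~ opposite x y]].
have good0 : good finset.set0 by apply/and3P; split; apply/forall_inP => x; rewrite inE.
have [S /maxsetP[/and3P[/forall_inP Slit /forall_inP Sclosed /forall_inP Scons] Smax] _]
  := maxset_exists good0.
have SclosedW x y : x \in S -> forces x y -> y \in S.
  by move=> /Sclosed/forallP/(_ y)/implyP; apply.
have Sconn x y : x \in S -> connect forces x y -> y \in S.
  move=> xS /connectP[p]; elim: p x xS => [|z p IH] x xS /=; first by move=> _ ->.
  by case/andP=> /(SclosedW _ _ xS)/IH.
have Sopp x y : x \in S -> y \in S -> ~~ opposite x y.
  by move=> /Scons/forall_inP; apply.
have extend x y : opposite x y -> ~~ connect forces x y -> (x \in S) || (y \in S).
  move=> xy nxy; apply/norP => -[xS yS].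
  pose T := [set z | connect forces x z].
  have Tlit z : z \in T -> z.2 \in L z.1.
    rewrite inE => /connectP[p]; case/lastP: p => [|p u].
      by move=> _ ->; case/and4P: xy.
    by rewrite rcons_path last_rcons => /andP[_ /and4P[_ _ uL _]] ->.
  have STopp z u : z \in S -> u \in T -> ~~ opposite z u.
    move=> zS; rewrite inE => xu; apply/negP => zu; case/negP: yS.
    apply: Sconn zS _; apply: connect_contra xu xy _.
    by rewrite opposite_sym.
  suff goodST : good (S :|: T).
    by case/negP: xS; rewrite -(Smax _ goodST (finset.subsetUl _ _)) !inE connect0 orbT.
  apply/and3P; split; apply/forall_inP => z /setUP[zS|zT].
  - exact: Slit.
  - exact: Tlit.
  - by apply/forallP => u; apply/implyP => /(SclosedW _ _ zS) uS; rewrite inE uS.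
  - apply/forallP => u; apply/implyP => zu; move: zT; rewrite !inE => zT.
    by rewrite (connect_trans zT (connect1 zu)) orbT.
  - by apply/forall_inP => u /setUP[uS|uT]; [apply: Sopp | apply: STopp].
  - apply/forall_inP => u /setUP[uS|uT]; first by rewrite opposite_sym STopp.
    apply/negP => zu; case/negP: nxy; move: zT uT; rewrite !inE => xz xu.
    by apply: connect_trans xu _; apply: connect_contra xz xy zu.
have total v : exists c, (v, c) \in S.
  have /card_gt0P[c cL] : 0 < #|L v| by rewrite card_L.
  have [[w d] xy] := @opposite_exists (v, c) cL.
  have /eqP/= vw : v == w by case/and4P: xy.
  subst w.
  have [cd|ncd] := boolP (connect forces (v, c) (v, d)).
    have yx : opposite (v, d) (v, c) by rewrite opposite_sym.
    have /orP[] := extend _ _ yx (acyc _ _ xy cd).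
      by exists d.
    by exists c.
  by have /orP[] := extend _ _ xy ncd; [exists c | exists d].
apply/existsP; exists [ffun v => xchoose (total v)].
have phiS v : (v, xchoose (total v)) \in S by exact: (xchooseP (total v)).
apply/andP; split; apply/forallP => v; first by rewrite ffunE; have := Slit _ (phiS v).
apply/forallP => w; apply/implyP => vw; rewrite !ffunE; apply/negP => /eqP vEw.
have wL := Slit _ (phiS w).
have [[w' d] /and4P[/eqP/= ww' _ dL cd]] := opposite_exists wL; subst w'.
have wdS : (w, d) \in S.
  by apply: SclosedW (phiS v) _; rewrite /forces /= vw vEw wL dL eq_sym.
by have := Sopp _ _ (phiS w) wdS; rewrite /opposite /= eqxx wL dL cd.
Qed.

(** Here [d] lists the inner colours, and [c], [c'] are the two end colours.  That
    each of them repeats an inner colour is a separate constraint on the colours.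
    The condition c = c', met by every closed walk of forcings around a cycle,
    would be one constraint only, and such cycles may well be colourable. *)
Definition bicycle : Prop := exists v z c d c',
  [/\ path G v z, uniq (v :: z), (1 < size d)%N, c \in d /\ c' \in d &
      [seq L w | w <- v :: z] = pairmap (fun a b => [set a; b]) c (rcons d c')].

Lemma forces_path_adj x y p :
  path forces x (y :: p) -> path G y.1 [seq z.1 | z <- p].
Proof.
rewrite /= => /andP[_]; elim: p y => [|z p IH] y //= /andP[/and4P[-> _ _ _]].
exact: IH.
Qed.

Lemma forces_path_lists x p : path forces x p ->
  [seq L y.1 | y <- p] = pairmap (fun a b => [set a; b]) x.2 [seq y.2 | y <- p].
Proof.
elim: p x => [|y p IH] x //= /andP[/and4P[_ xL yL yx] /IH->]; congr cons.
by apply: list_eq_set2 => //; rewrite eq_sym.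
Qed.

Lemma forces_path_mem x p y : path forces x p -> y \in p ->
  exists2 c, c \in x.2 :: [seq z.2 | z <- p] & L y.1 = [set c; y.2].
Proof.
move=> xp yp; case/splitPr: yp xp => p1 p2; rewrite cat_path /=.
case/and3P=> _ /and4P[_ cL yL yc] _; exists (last x p1).2.
  by rewrite -last_map map_cat -cat_cons mem_cat mem_last.
by apply: list_eq_set2 => //; rewrite eq_sym.
Qed.

(** Shortening p reduces to distinct vertices on p: a repeated choice is cut out,
    and a vertex that occurs with opposite choices starts a shorter cycle of the
    same kind.  The last two choices on p are then a and b, where b is opposite to
    x, so that a has the colour of x: the starting colour repeats.  Walking on
    from b towards x must meet a vertex seen before, and at the first such moment
    the last colour lies in the list of an earlier vertex, so it repeats too. *)
Lemma bicycle_of_cycle x p : path forces x p -> opposite x (last x p) ->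
  connect forces (last x p) x -> bicycle.
Proof.
have [n] := ubnP (size p); elim: n x p => // n IH x p sp xp opp back.
have [up|/split_repeat[p1 [u [p2 [w [p3 [pE uw1]]]]]]] :=
    boolP (uniq [seq y.1 | y <- p]); last first.
  move: xp; rewrite pE cat_path /= cat_path /=.
  case/and5P=> xp1 p1u up2 p2w wp3.
  have lastE : last x p = last w p3 by rewrite pE last_cat /= last_cat.
  have [uw|uw] := eqVneq u w.
    subst w; apply: (IH x (p1 ++ u :: p3)).
    - by move: sp; rewrite pE !size_cat /= size_cat /=; lia.
    - by rewrite cat_path /= xp1 p1u.
    - by rewrite last_cat /= -lastE.
    - by rewrite last_cat /= -lastE.
  apply: (IH u (rcons p2 w)).
  - by move: sp; rewrite pE size_rcons !size_cat /= size_cat /=; lia.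
  - by rewrite rcons_path up2.
  - rewrite last_rcons /opposite uw1 eqxx /=.
    case/and4P: p1u => _ _ uL _; case/and4P: p2w => _ _ wL _.
    rewrite -{1}uw1 uL wL /=; apply: contra uw => /eqP uw2.
    by case: (u) (w) uw1 uw2 => ? ? [? ?] /= -> ->.
  - rewrite last_rcons; apply: (@connect_trans _ _ (last w p3)).
      by apply/connectP; exists p3.
    rewrite -lastE; apply: connect_trans back _.
    by apply/connectP; exists (rcons p1 u); rewrite ?rcons_path ?xp1 // last_rcons.
clear sp.
have xlit : x.2 \in L x.1 by case/and4P: opp.
case/lastP: p => [|p b] in xp opp back up *; first by case/and4P: opp => _ _ _ /eqP.
rewrite last_rcons in opp back.
case/lastP: p => [|p a] in xp up *.
  case/and4P: opp => /eqP xb _ _ _; move: xp => /= /andP[/and4P[+ _ _ _] _].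
  by rewrite xb adj_irrefl.
have /and3P[xp' pa ab] : [&& path forces x p, forces (last x p) a & forces a b].
  by move: xp; rewrite !rcons_path last_rcons andbA.
(* The list at x is {x.2, b.2}, and a forces b, so a has the colour x.2. *)
have ax : a.2 = x.2.
  case/and4P: opp => /eqP xb1 _ bL xb2; case/and4P: ab => _ aL _ ba.
  rewrite -xb1 in aL; move: aL; rewrite (list_eq_set2 xlit bL xb2).
  by case/set2P => // ab2; rewrite ab2 eqxx in ba.
(* The path needs at least three vertices: x, a and one between them, as a has
   the colour of x and so is not forced by x itself. *)
have p_gt0 : 0 < size p.
  by case: p pa {xp up xp'} => //= /and4P[_ _ _]; rewrite ax eqxx.
have [q bq xE] := connectP back.
have := @uniq_prefix _ _ [seq y.1 | y <- q] up.
case=> [|t1 [u [t2 [qE ut us]]]].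
  rewrite cat_uniq !negb_and negbK; apply/orP; right; apply/orP; left.
  apply/hasP; exists x.1; last first.
    by rewrite /= map_rcons mem_rcons inE; case/andP: opp => ->.
  case/lastP: q {bq} xE => [|q y] /=.
    by move=> xb; case/and4P: opp => _ _ _; rewrite xb eqxx.
  by rewrite last_rcons => ->; rewrite map_rcons mem_rcons inE eqxx.
(* q1 is the part of the walk back to x before its first repeated vertex, y.1. *)
pose q1 := take (size t1) q.
have q1E : [seq y.1 | y <- q1] = t1 by rewrite map_take qE take_size_cat.
have [y [q2 [qE' yu]]] : exists y q2, q = q1 ++ y :: q2 /\ y.1 = u.
  case E : (drop (size t1) q) => [|y q2].
    by move: (congr1 (map fst) E); rewrite map_drop qE drop_size_cat.
  exists y, q2; rewrite -E cat_take_drop; split=> //.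
  by move: (congr1 (map fst) E); rewrite map_drop qE drop_size_cat //= => -[->].
have [xP Py] : path forces x (rcons (rcons p a) b ++ q1) /\
               forces (last x (rcons (rcons p a) b ++ q1)) y.
  move: bq; rewrite qE' !cat_path xp /= last_cat !last_rcons.
  by case/and3P => -> ->.
rewrite -q1E -map_cat in ut us; rewrite -yu in us.
(* In Q every colour is inner; the colour of the last choice b' is the end colour. *)
have [Q [b' [PE aQ Qs]]] : exists Q b',
    [/\ rcons (rcons p a) b ++ q1 = rcons Q b', a \in Q & 1 < size Q].
  case/lastP: (q1) => [|q1' b'].
    by exists (rcons p a), b; rewrite cats0 mem_rcons mem_head size_rcons ltnS.
  exists (rcons (rcons p a) b ++ q1'), b'; rewrite -rcons_cat; split=> //.
    by rewrite mem_cat mem_rcons inE mem_rcons mem_head orbT.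
  by rewrite size_cat !size_rcons.
rewrite {}PE last_rcons in xP Py ut us.
have [y0 [P' PE]] : exists y0 P', rcons Q b' = y0 :: P'.
  by case: (Q) => [|y0 Q']; [exists b', [::] | exists y0, (rcons Q' b')].
have xd : x.2 \in [seq z.2 | z <- Q] by rewrite -ax map_f.
exists y0.1, [seq z.1 | z <- P'], x.2, [seq z.2 | z <- Q], b'.2; split.
- by apply: (@forces_path_adj x); rewrite -PE.
- by move: ut; rewrite PE.
- by rewrite size_map.
- split=> //.
  have /and4P[b'y b'L _ _] := Py.
  move: us; rewrite map_rcons mem_rcons inE => /orP[/eqP yb|].
    by rewrite yb adj_irrefl in b'y.
  case/mapP => w wQ yw; move: xP; rewrite rcons_path => /andP[xQ _].
  have [c cQ Lw] := forces_path_mem xQ wQ.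
  move: b'L; rewrite yw Lw => /set2P[->|->]; last exact: map_f.
  by move: cQ; rewrite inE => /orP[/eqP->|].
- by rewrite -(map_rcons snd) -forces_path_lists // PE /= -map_comp.
Qed.

Lemma bicycle_of_uncolorable : ~~ list_colorable G L -> bicycle.
Proof.
move=> nc; apply: contrapT => nb; case/negP: nc.
apply: colorable_of_acyclic => x y xy cxy; apply/negP => cyx; apply: nb.
have [p xp yE] := connectP cxy; subst y.
exact: bicycle_of_cycle xp xy cyx.
Qed.
End Forcing.

Local Open Scope ring_scope.

(** * Probabilities of events of random lists *)

Section RandomLists.
Variables (R : realType) (V C : finType).
Implicit Types (A : pred (list_assignment V C)) (L : list_assignment V C).

Lemma klist_pmf_ge0 k (S : {set C}) : 0 <= klist_pmf R k S.
Proof. by rewrite /klist_pmf; case: ifP => // _; rewrite invr_ge0. Qed.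

Lemma list_weight_ge0 k L : 0 <= \prod_(v : V) klist_pmf R k (L v).
Proof. by apply: prodr_ge0 => v _; apply: klist_pmf_ge0. Qed.

Lemma list_prob_ge0 k A : 0 <= list_prob R k A.
Proof. by apply: sumr_ge0 => L _; apply: list_weight_ge0. Qed.

(** It is enough to cover A on assignments whose lists have size k, since the
    others have weight zero. *)
Lemma list_prob_union k (X : finType) A (E : X -> pred (list_assignment V C)) :
  (forall L, (forall v, #|L v| = k) -> A L -> exists x, E x L) ->
  list_prob R k A <= \sum_x list_prob R k (E x).
Proof.
move=> AE; under eq_bigr => x _ do rewrite /list_prob big_mkcond.
rewrite exchange_big /list_prob big_mkcond /=; apply: ler_sum => L _.
have sum_ge0 (P : pred X) :
    0 <= \sum_(x | P x) if E x L then \prod_v klist_pmf R k (L v) else 0.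
  by apply: sumr_ge0 => x _; case: ifP => // _; apply: list_weight_ge0.
case: ifPn => // AL.
have [/forallP/(_ _)/eqP Lk|/forallPn[v Lv]] := boolP [forall v, #|L v| == k].
  have [x xL] := AE L Lk AL.
  by rewrite (bigD1 x) //= xL lerDl sum_ge0.
by rewrite {1}(bigD1 v) //= {1}/klist_pmf (negPf Lv) mul0r sum_ge0.
Qed.

Lemma list_prob_compl k A : (k <= #|C|)%N ->
  list_prob R k A = 1 - list_prob R k (fun L => ~~ A L).
Proof.
by move=> kC; rewrite -(list_prob_true R V kC) {2}/list_prob (bigID A) /= /list_prob addrK.
Qed.

Lemma list_prob_mono k A (B : pred (list_assignment V C)) :
  (forall L, A L -> B L) -> list_prob R k A <= list_prob R k B.
Proof.
move=> AB; rewrite /list_prob big_mkcond [X in _ <= X]big_mkcond.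
apply: ler_sum => L _; case: ifP => [/AB->//|_].
by case: ifP => // _; apply: list_weight_ge0.
Qed.

(** The weight of the event factors over the vertices: a vertex in D contributes the
    probability of one given list, every other vertex contributes 1. *)
Lemma list_prob_prescribed k (D : {set V}) (T : V -> {set C}) : (k <= #|C|)%N ->
  list_prob R k (fun L => [forall v in D, L v == T v]) <=
  ('C(#|C|, k)%:R^-1) ^+ #|D|.
Proof.
move=> kC.
pose F v (S : {set C}) : R := if (v \in D) ==> (S == T v) then klist_pmf R k S else 0.
have -> : list_prob R k (fun L => [forall v in D, L v == T v]) =
    \sum_(L : list_assignment V C) \prod_v F v (L v).
  rewrite /list_prob big_mkcond; apply: eq_bigr => L _.
  case: ifPn => [/forallP DT|/forallPn[v /negPf vT]].
    by apply: eq_bigr => v _; rewrite /F DT.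
  by rewrite (bigD1 v) //= /F vT mul0r.
rewrite -(bigA_distr_bigA F) -prodr_const [X in _ <= X]big_mkcond /=.
apply: ler_prod => v _; rewrite sumr_ge0 /=; last first.
  by move=> S _; rewrite /F; case: ifP => // _; apply: klist_pmf_ge0.
rewrite /F; case: ifPn => _ /=; last by rewrite klist_pmf_sum1.
rewrite -big_mkcond big_pred1_eq /klist_pmf.
by case: ifP => // _; rewrite invr_ge0.
Qed.

Lemma list_prob_prescribed_seq k (z : seq V) (t : seq {set C}) : (k <= #|C|)%N ->
  list_prob R k (fun L => uniq z && ([seq L v | v <- z] == t)) <=
  ('C(#|C|, k)%:R^-1) ^+ size z.
Proof.
move=> kC; have [uz|] := boolP (uniq z); last first.
  by rewrite {1}/list_prob big_pred0_eq exprn_ge0 // invr_ge0.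
have <- : #|[set v in z]| = size z by rewrite cardsE; apply/card_uniqP.
pose T v := nth finset.set0 t (index v z).
apply: le_trans (list_prob_prescribed _ T kC).
apply: list_prob_mono => L /= /eqP Lt; apply/forall_inP => v; rewrite inE => vz.
by rewrite /T -Lt (nth_map v) ?index_mem // nth_index.
Qed.

Lemma list_prob_union_const k (X : finType) A
    (E : X -> pred (list_assignment V C)) (p : R) :
  (forall L, (forall v, #|L v| = k) -> A L -> exists x, E x L) ->
  (forall x, list_prob R k (E x) <= p) -> list_prob R k A <= #|X|%:R * p.
Proof.
move=> AE Ep; apply: le_trans (list_prob_union AE) _.
by rewrite mulr_natl -sumr_const; apply: ler_sum.
Qed.

End RandomLists.

(** * Counting bicycles *)

Section Bicycles.
Variables (R : realType) (V C : finType) (G : sgraph V).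
Hypothesis card_C : (2 <= #|C|)%N.

(** Numbering the neighbours of each vertex lets a walk be coded by its start and a
    word over max_degree G letters, which makes the count of walks immediate. *)
Definition neighbour (v : V) (i : 'I_(max_degree G)) : V := nth v (enum (G v)) i.

Lemma walk_neighbour v z : path G v z ->
  exists2 e : seq 'I_(max_degree G), size e = size z & scanl neighbour v e = z.
Proof.
elim: z v => [|w z IH] v /=; first by exists [::].
case/andP=> vw /IH[e <- <-].
have wv : w \in enum (G v) by rewrite mem_enum.
have lt_i : (index w (enum (G v)) < max_degree G)%N.
  rewrite (@leq_trans (degree G v)) //; last exact: leq_bigmax.
  by move: wv; rewrite -index_mem -cardE /degree cardsE.
by exists (Ordinal lt_i :: e) => //=; rewrite /neighbour /= nth_index.
Qed.

(** The code of a bicycle: the start and steps of its path, its inner colours, and the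
    positions at which the end colours occur among them. *)
Definition bicycle_event k
    (x : V * k.-tuple 'I_(max_degree G) * k.-tuple C * 'I_k * 'I_k)
    (L : list_assignment V C) :=
  let: (v, e, d, i, j) := x in
  uniq (v :: scanl neighbour v e) &&
  ([seq L w | w <- v :: scanl neighbour v e] ==
   pairmap (fun a b => [set a; b]%SET) (tnth d i) (rcons d (tnth d j))).

Lemma bicycle_event_exists (L : list_assignment V C) :
  bicycle G L -> exists k : 'I_#|V|, (1 < k)%N && [exists x, @bicycle_event k x L].
Proof.
case=> v [z [c [d [c' [Gz uz d1 [cd c'd] LE]]]]].
have sz : size z = size d.
  by move: (congr1 size LE); rewrite size_map size_pairmap size_rcons /= => -[].
have dV : (size d < #|V|)%N.
  by rewrite -sz -[(size z).+1]/(size (v :: z)) -(card_uniqP uz) max_card.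
have [e se ze] := walk_neighbour Gz.
exists (Ordinal dV); rewrite /= d1; apply/existsP.
have se' : size e == size d by rewrite se sz.
have ci : (index c d < size d)%N by rewrite index_mem.
have ci' : (index c' d < size d)%N by rewrite index_mem.
exists (v, Tuple se', in_tuple d, Ordinal ci, Ordinal ci').
by rewrite /bicycle_event ze LE !(tnth_nth c) !nth_index // eqxx andbT.
Qed.

Lemma prob_uncolorable_le_sum :
  list_prob R 2 (fun L : list_assignment V C => ~~ list_colorable G L) <=
  \sum_(k < #|V| | (1 < k)%N)
    (#|V| * max_degree G ^ k * #|C| ^ k * k * k)%:R * ('C(#|C|, 2)%:R^-1) ^+ k.+1.
Proof.
apply: le_trans (list_prob_union R (E := fun (k : 'I_#|V|) L =>
  (1 < k)%N && [exists x, @bicycle_event k x L]) _) _.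
  by move=> L L2 /(bicycle_of_uncolorable L2)/bicycle_event_exists.
rewrite [X in _ <= X]big_mkcond; apply: ler_sum => k _; case: ifP => k1; last first.
  by rewrite /list_prob big_pred0_eq.
have -> : (#|V| * max_degree G ^ k * #|C| ^ k * k * k)%N =
  #|{: V * k.-tuple 'I_(max_degree G) * k.-tuple C * 'I_k * 'I_k}|.
  by rewrite !card_prod !card_tuple !card_ord.
apply: (list_prob_union_const (E := @bicycle_event k)).
  by move=> L _ /existsP.
case=> -[[[v e] d] i] j; apply: le_trans (list_prob_prescribed_seq _ _ _ card_C) _.
by rewrite /= size_scanl size_tuple.
Qed.
End Bicycles.

(** * Estimating the expected number of bicycles *)

Section NumericBound.
Variable R : realType.

Lemma inv_bin2_le (s : nat) : (2 <= s)%N -> ('C(s, 2)%:R^-1 : R) <= 4 / s%:R ^+ 2.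
Proof.
move=> s2; have s0 : (0 < s%:R :> R) by rewrite ltr0n; lia.
rewrite -[leRHS]invrK lef_pV2 ?posrE ?ltr0n ?bin_gt0 //; last first.
  by rewrite invr_gt0 divr_gt0 // exprn_gt0.
rewrite invf_div ler_pdivrMr // -natrX -natrM ler_nat.
by have := mul_bin_diag s 1; rewrite bin1; nia.
Qed.

Lemma sqr_le_expn2 k : (k * k <= 2 ^ k.+1)%N.
Proof.
elim: k => // k; rewrite [(2 ^ k.+2)%N]expnS => IH.
have [k2|k2] := leqP k 2; last by nia.
by case: k k2 {IH} => [|[|[|]]].
Qed.

(** With q = x / s <= 1 / 16 the term is at most 64 y k^2 (4 q)^(k-2), where
    y = n x^2 / s^4; as 4 q <= 1 / 4 and k^2 <= 2^(k+1), geometric decay survives. *)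
Lemma bicycle_term_le (N D s k : nat) (x : R) : (2 <= s)%N -> (1 < k)%N ->
  D%:R <= x -> 16 * x <= s%:R ->
  (N * D ^ k * s ^ k * k * k)%:R * ('C(s, 2)%:R^-1) ^+ k.+1 <=
  2 ^+ 11 * (N%:R * x ^+ 2 / s%:R ^+ 4) * (2^-1) ^+ k.
Proof.
move=> s2; case: k => [|[|m]] // _ Dx xs.
have s0 : (0 < s%:R :> R) by rewrite ltr0n; lia.
have x0 : 0 <= x by apply: le_trans Dx; rewrite ler0n.
have y0 : 0 <= N%:R * x ^+ 2 / s%:R ^+ 4.
  by rewrite divr_ge0 ?mulr_ge0 ?exprn_ge0 // ltW.
apply: (@le_trans _ _ ((N%:R * x ^+ 2 / s%:R ^+ 4) *
   (64 * ((m.+2 * m.+2)%:R * (4 * x / s%:R) ^+ m)))).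
  apply: (@le_trans _ _ (N%:R * x ^+ m.+2 * s%:R ^+ m.+2 * (m.+2 * m.+2)%:R *
      (4 / s%:R ^+ 2) ^+ m.+3)).
    apply: ler_pM => //.
      rewrite -mulnA natrM; apply: ler_wpM2r => //.
      rewrite natrM (natrM _ N) !natrX; apply: ler_wpM2r; first exact: exprn_ge0.
      by apply: ler_wpM2l => //; apply: lerXn2r; rewrite ?nnegrE.
    by apply: lerXn2r; rewrite ?nnegrE ?invr_ge0 ?inv_bin2_le // divr_ge0 // sqr_ge0.
  rewrite le_eqVlt; apply/orP; left; apply/eqP.
  have sn0 : s%:R != 0 :> R by rewrite gt_eqF.
  have -> : (4 * x / s%:R) ^+ m = x ^+ m * s%:R ^+ m * (4 / s%:R ^+ 2) ^+ m.
    by rewrite -!exprMn; congr (_ ^+ m); field.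
  rewrite !exprS; set w := _ ^+ m; set t := x ^+ m; set u := s%:R ^+ m.
  by field.
rewrite [2 ^+ 11 * _]mulrC -[leRHS]mulrA; apply: ler_wpM2l => //.
have q4 : 4 * x / s%:R <= 2^-1 * 2^-1 by rewrite ler_pdivrMr //; lra.
apply: (@le_trans _ _ (64 * ((2 ^ m.+3)%:R * (2^-1 * 2^-1) ^+ m))).
  rewrite ler_pM2l //; apply: ler_pM => //.
  - by rewrite exprn_ge0 // divr_ge0 ?mulr_ge0 // ltW.
  - by rewrite ler_nat sqr_le_expn2.
  - by apply: lerXn2r; rewrite ?nnegrE ?divr_ge0 ?mulr_ge0 // ltW.
have -> : 2 ^+ 11 * 2^-1 ^+ m.+2 = 512 * 2^-1 ^+ m :> R by rewrite !exprS; field.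
rewrite natrX !exprS exprMn.
rewrite le_eqVlt; apply/orP; left; apply/eqP.
have h : 2 ^+ m * 2^-1 ^+ m = 1 :> R by rewrite -exprMn mulfV ?expr1n.
transitivity (512 * (2 ^+ m * 2^-1 ^+ m) * 2^-1 ^+ m : R); last by rewrite h mulr1.
by ring.
Qed.

Lemma sum_half_pow_le n : \sum_(k < n) (2^-1 : R) ^+ k <= 2.
Proof.
suff -> : \sum_(k < n) (2^-1 : R) ^+ k = 2 - 2 * 2^-1 ^+ n.
  by rewrite gerBl mulr_ge0 // exprn_ge0.
elim: n => [|n IH]; first by rewrite big_ord0 expr0 mulr1 subrr.
by rewrite big_ord_recr /= IH exprS; field.
Qed.

Lemma prob_uncolorable_le (V C : finType) (G : sgraph V) (x : R) :
  (2 <= #|C|)%N -> (max_degree G)%:R <= x -> 16 * x <= #|C|%:R ->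
  list_prob R 2 (fun L : list_assignment V C => ~~ list_colorable G L) <=
  2 ^+ 12 * (#|V|%:R * x ^+ 2 / #|C|%:R ^+ 4).
Proof.
move=> C2 Dx xC; apply: le_trans (prob_uncolorable_le_sum R G C2) _.
set y := _ / _.
have y0 : 0 <= y by rewrite divr_ge0 ?mulr_ge0 ?exprn_ge0 // (le_trans _ Dx).
apply: (@le_trans _ _ (\sum_(k < #|V|) 2 ^+ 11 * y * 2^-1 ^+ k)).
  rewrite big_mkcond; apply: ler_sum => k _; case: ifP => k1.
    exact: bicycle_term_le.
  by apply: mulr_ge0; [apply: mulr_ge0|]; rewrite // exprn_ge0.
rewrite -mulr_sumr (_ : 2 ^+ 12 * y = 2 ^+ 11 * y * 2); last by ring.
by apply: ler_wpM2l; [apply: mulr_ge0; rewrite // exprn_ge0|exact: sum_half_pow_le].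
Qed.
End NumericBound.

(** * The asymptotic statement *)

Lemma powR_inv_exprn (R : realType) (m : nat) (a : R) :
  (0 < m)%N -> 0 <= a -> (a `^ (1 / m%:R)) ^+ m = a.
Proof.
move=> m0 a0; rewrite -powR_mulrn ?powR_ge0 // -powRrM mul1r mulVf ?powRr1 //.
by rewrite pnatr_eq0 -lt0n.
Qed.

Local Open Scope classical_set_scope.

Theorem theorem1p5 (R : realType) (G : forall n : nat, sgraph 'I_n)
    (Delta : nat -> R) (sigma : nat -> nat)
    (hDelta : forall n : nat, (max_degree (G n))%:R <= Delta n)
    (hsigma : forall n : nat, (2 <= sigma n)%N)
    (hcase :
      ( Delta =o_\oo (fun n : nat => n%:R `^ (1 / 2) : R)
        /\ (fun n : nat => n%:R `^ (1 / 4) * Delta n `^ (1 / 2) : R)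
             =o_\oo (fun n : nat => (sigma n)%:R : R) )
      \/
      ( Delta =Omega_\oo (fun n : nat => n%:R `^ (1 / 2) : R)
        /\ Delta =o_\oo (fun n : nat => (sigma n)%:R : R) )) :
  (fun n : nat =>
     list_prob R 2 (fun L : list_assignment 'I_n 'I_(sigma n) =>
                      list_colorable (G n) L)) @ \oo --> (1 : R).
Proof.
have D0 n : 0 <= Delta n by apply: le_trans (hDelta n); rewrite ler0n.
have s0 n : 0 < (sigma n)%:R :> R by rewrite ltr0n; have := hsigma n; lia.
suff lims (e : R) : 0 < e ->
    (\forall n \near \oo, Delta n <= e * (sigma n)%:R /\
       n%:R * Delta n ^+ 2 <= e * (sigma n)%:R ^+ 4).
  apply/cvgrPdist_le => e e0.
  have e1 : 0 < Num.min 16^-1 (e / 2 ^+ 12).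
    rewrite lt_min; apply/andP; split; first by rewrite invr_gt0 ltr0n.
    by apply: divr_gt0 => //; rewrite exprn_gt0.
  near=> n.
  have [h1 h2] : Delta n <= Num.min 16^-1 (e / 2 ^+ 12) * (sigma n)%:R /\
     n%:R * Delta n ^+ 2 <= Num.min 16^-1 (e / 2 ^+ 12) * (sigma n)%:R ^+ 4.
    by near: n; apply: lims.
  have C2 : (2 <= #|'I_(sigma n)|)%N by rewrite card_ord.
  rewrite list_prob_compl // opprB addrC subrK ger0_norm ?list_prob_ge0 //.
  apply: le_trans (prob_uncolorable_le C2 (hDelta n) _) _; rewrite !card_ord.
    rewrite -ler_pdivlMl // (le_trans h1) // ler_wpM2r ?(ltW (s0 _)) //.
    by rewrite ge_min lexx.
  rewrite -ler_pdivlMl ?exprn_gt0 // ler_pdivrMr ?exprn_gt0 // (le_trans h2) //.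
  by rewrite ler_wpM2r ?exprn_ge0 ?(ltW (s0 _)) // ge_min mulrC lexx orbT.
have pow4_le (a b : R) : 0 <= a -> a <= 1 -> a <= b -> a ^+ 4 <= b.
  by move=> a0 a1; apply: le_trans; apply: ler_iXnr.
move=> e0; case: hcase => -[hD hs].
  (* The bound 1 gives b ^+ 4 <= b. *)
  pose b := Num.min 1 e.
  have b0 : 0 < b by rewrite lt_min ltr01.
  have [b1 be] : b <= 1 /\ b <= e by rewrite !ge_min !lexx orbT.
  have /eqoP/(_ 1 ltr01) hD1 := hD.
  have /eqoP/(_ b b0) hsb := hs.
  near=> n.
  have : `|Delta n| <= 1 * `|n%:R `^ (1 / 2) : R| by near: n.
  have : `|n%:R `^ (1 / 4) * Delta n `^ (1 / 2) : R| <= b * `|(sigma n)%:R : R|.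
    by near: n.
  rewrite !ger0_norm ?mulr_ge0 ?powR_ge0 // [1 * _ `^ _]mul1r.
  have tE := @powR_inv_exprn _ 4%N _ isT (ler0n R n).
  have rE := @powR_inv_exprn _ 2%N _ isT (D0 n).
  have -> : n%:R `^ (1 / 2) = (n%:R `^ (1 / 4)) ^+ 2 :> R.
    by rewrite -powR_mulrn ?powR_ge0 // -powRrM; congr (_ `^ _); field.
  have t0 := powR_ge0 (n%:R : R) (1 / 4); have r0 := powR_ge0 (Delta n) (1 / 2).
  move: (n%:R `^ (1 / 4)) (Delta n `^ (1 / 2)) tE rE t0 r0 => t r <- <- t0 r0 trs.
  rewrite ler_pXn2r ?nnegrE // => rt; split.
    apply: (@le_trans _ _ (t * r)); first by rewrite expr2 ler_wpM2r.
    by apply: le_trans trs _; rewrite ler_wpM2r // ltW.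
  rewrite -exprM -exprMn; apply: (@le_trans _ _ ((b * (sigma n)%:R) ^+ 4)).
    by apply: lerXn2r; rewrite ?nnegrE ?mulr_ge0 // ltW.
  by rewrite exprMn ler_wpM2r ?exprn_ge0 // pow4_le // ltW.
have [k k0 hk] : exists2 k : R, 0 < k &
    \forall n \near \oo, k * `|n%:R `^ (1 / 2) : R| <= `|Delta n|.
  by rewrite hD; apply: bigOmegaP.
(* The last bound absorbs the constant of k ^+ 2 * n <= Delta ^+ 2. *)
pose b := Num.min 1 (Num.min e (k ^+ 2 * e)).
have b0 : 0 < b by rewrite !lt_min ltr01 e0 mulr_gt0 // exprn_gt0.
have [b1 be bke] : [/\ b <= 1, b <= e & b <= k ^+ 2 * e].
  by rewrite !ge_min !lexx !orbT.
have /eqoP/(_ b b0) hsb := hs.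
near=> n.
have : k * `|n%:R `^ (1 / 2) : R| <= `|Delta n| by near: n.
have : `|Delta n| <= b * `|(sigma n)%:R : R| by near: n.
rewrite !ger0_norm ?powR_ge0 //.
have qE := @powR_inv_exprn _ 2%N _ isT (ler0n R n).
have q0 := powR_ge0 (n%:R : R) (1 / 2).
move: (n%:R `^ (1 / 2)) qE q0 => q <- q0 xs qx; split.
  by apply: le_trans xs _; rewrite ler_wpM2r // ltW.
rewrite -(ler_pM2l (exprn_gt0 2 k0)) (mulrA _ (q ^+ 2)) -exprMn.
apply: (@le_trans _ _ ((b * (sigma n)%:R) ^+ 4)).
  apply: (@le_trans _ _ (Delta n ^+ 2 * Delta n ^+ 2)).
    rewrite ler_wpM2r ?exprn_ge0 //.
    by apply: lerXn2r; rewrite ?nnegrE ?mulr_ge0 // ltW.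
  by rewrite -exprD; apply: lerXn2r; rewrite ?nnegrE ?mulr_ge0 // ltW.
by rewrite exprMn [leRHS]mulrA ler_wpM2r ?exprn_ge0 // pow4_le // ltW.
Unshelve. all: by end_near.
Qed.
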